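(* Chamberlin--Courant approval voting (CCAV) is the only Thiele rule that satisfies weak representation and strategyproofness for unrepresented voters for all committee sizes $k$, numbers of parties $m$, and numbers of voters $n$. That is: the $w$-Thiele rule with $w=(1,0,0,\dots)$ satisfies both axioms for all $k,m,n\geq 1$, and for every other admissible weight vector $w$ there are $k,m,n\geq 1$ for which the $w$-Thiele rule violates at least one of the two axioms.
   Context: Setting. $N=\{1,\dots,n\}$ is a set of $n$ voters and $\mathcal P$ a set of $m$ parties. An approval ballot is a non-empty subset of $\mathcal P$; $\mathcal A$ is the set of all approval ballots. An approval profile is $A=(A_1,\dots,A_n)\in\mathcal A^n$, where $A_i$ is the ballot of voter $i$. A committee of size $k$ is a multiset of parties of total size $k$, i.e. a function $W:\mathcal P\to\{0,1,2,\dots\}$ with $\sum_{x\in\mathcal P}W(x)=k$; write $W(X)=\sum_{x\in X}W(x)$ for $X\subseteq\mathcal P$, and let $\mathcal W_k$ be the set of all committees of size $k$. A party-approval rule $f$ maps each profile $A\in\mathcal A^n$ and committee size $k$ to a single committee $f(A,k)\in\mathcal W_k$. Write $f(A,k,x)$ for the number of seats of $x$ in $f(A,k)$ and $f(A,k,X)=\sum_{x\in X}f(A,k,x)$. Thiele rules. An admissible weight vector is an infinite non-increasing sequence $w=(w_1,w_2,\dots)$ of non-negative reals, normalized so that $w_1=1$. The $w$-Thiele rule chooses, for profile $A$ and committee size $k$, the committee $W\in\mathcal W_k$ maximizing $s_w(W,A)=\sum_{i\in N}\sum_{j=1}^{W(A_i)}w_j$. Ties are broken lexicographically: for every $k$ (and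 set of parties) there is a fixed arbitrary linear order $\succ_k$ on $\mathcal W_k$, independent of the profile, and among all score-maximizing committees the best one according to $\succ_k$ is chosen. CCAV is the $w$-Thiele rule with $w=(1,0,0,\dots)$. Axioms (for given $k,m,n$): - Weak representation: $f(A,k,x)\geq 1$ for every profile $A$, party $x$, and group of voters $G\subseteq N$ with $|G|\geq \frac nk$ and $A_i=\{x\}$ for all $i\in G$. - Strategyproofness for unrepresented voters: $f(A,k,A_i)\geq f(A',k,A_i)$ for all profiles $A,A'$ and voters $i\in N$ such that $A_j=A'_j$ for all $j\in N\setminus\{i\}$ and $f(A,k,A_i)=0$. *)

(* Defs.v *)
From HB Require Import structures.
From mathcomp Require Import all_boot all_order all_algebra.
From mathcomp Require Import reals.
Set Implicit Arguments.
Unset Strict Implicit.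
Unset Printing Implicit Defensive.
Import Order.TTheory GRing.Theory Num.Theory.
Local Open Scope ring_scope.

Definition ballot (m : nat) := {B : {set 'I_m} | B != set0}.

Definition profile (m n : nat) := {ffun 'I_n -> ballot m}.

(* A multiset of total size k has multiplicities at most k, so multiplicities
   are taken in 'I_k.+1; this makes the type of committees finite. *)
Definition committee (m k : nat) :=
  {W : {ffun 'I_m -> 'I_k.+1} | (\sum_x W x)%N == k}.

Definition seats (m k : nat) (W : committee m k) (X : {set 'I_m}) : nat :=
  (\sum_(x in X) val W x)%N.

Definition rule (m n k : nat) := profile m n -> committee m k.

(* Weight vectors are indexed from 0: [w j] is the weight w_{j+1}. *)
Definition admissible (R : realType) (w : nat -> R) : Prop :=
  [/\ w 0%N = 1, forall j, 0 <= w j & forall j, w j.+1 <= w j].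

Definition ccav_weights (R : realType) : nat -> R := fun j => (j == 0%N)%:R.

Definition score (R : realType) (w : nat -> R) (m n k : nat)
    (A : profile m n) (W : committee m k) : R :=
  \sum_(i < n) \sum_(j < seats W (val (A i))) w j.

Definition optimal (R : realType) (w : nat -> R) (m n k : nat)
    (A : profile m n) : pred (committee m k) :=
  fun W => [forall W' : committee m k, score w A W' <= score w A W].

(* Linear orders are given in weak form; [r W W'] reads
   "W is preferred to W' or W = W'". *)
Definition linear_order (T : Type) (r : rel T) : Prop :=
  [/\ reflexive r, antisymmetric r, transitive r & total r].

Fact all_to_proof (m k : nat) (x : 'I_m) :
  (\sum_y [ffun y => if y == x then ord_max else ord0 : 'I_k.+1] y)%N == k.
Proof.
rewrite (bigD1 x) //= ffunE eqxx /= big1 ?addn0 // => y /negbTE yx.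
by rewrite ffunE yx.
Qed.

Definition all_to (m k : nat) (x : 'I_m) : committee m k :=
  exist (fun W : {ffun 'I_m -> 'I_k.+1} => (\sum_y W y)%N == k) _
        (all_to_proof k x).

(* The inner arg max (and [all_to], which only witnesses that committees exist
   when m > 0) merely provides an optimal committee as default value of
   [extremum], which selects the most preferred optimal committee; see
   [thieleP]. *)
Definition thiele (R : realType) (w : nat -> R) (m n k : nat)
    (tie : rel (committee m k)) (m_gt0 : (0 < m)%N) : rule m n k :=
  fun A =>
    let W0 := [arg max_(W > all_to k (Ordinal m_gt0)) score w A W]%O in
    extremum tie W0 (optimal w A) id.

Lemma thieleP (R : realType) (w : nat -> R) (m n k : nat)
    (tie : rel (committee m k)) (m_gt0 : (0 < m)%N) (A : profile m n)
    (W : committee m k) :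
  linear_order tie ->
  (thiele w tie m_gt0 A = W) <->
  (optimal w A W /\ forall W', optimal w A W' -> tie W W').
Proof.
case=> tr ta tt tl; rewrite /thiele; case: arg_maxP => // W1 _ W1max.
have optW1 : optimal w A W1 by apply/forallP=> W'; exact: W1max.
case: extremumP => // W2 optW2 bestW2; split=> [<- //|[optW bestW]].
by apply: ta; rewrite bestW2 // bestW.
Qed.

Lemma admissible_ccav (R : realType) : admissible (@ccav_weights R).
Proof. by split=> // j; rewrite /ccav_weights ?ler0n //= ler0n. Qed.

Definition weak_representation (m n k : nat) (f : rule m n k) : Prop :=
  forall (A : profile m n) (x : 'I_m) (G : {set 'I_n}),
    n%:R / k%:R <= #|G|%:R :> rat ->
    (forall i, i \in G -> val (A i) = [set x]) ->
    (1 <= seats (f A) [set x])%N.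

Definition strategyproof_unrepresented (m n k : nat) (f : rule m n k) : Prop :=
  forall (A A' : profile m n) (i : 'I_n),
    (forall j, j != i -> A j = A' j) ->
    seats (f A) (val (A i)) = 0%N ->
    (seats (f A) (val (A i)) >= seats (f A') (val (A i)))%N.

(* Main.v *)
(** Under CCAV, a group that is entitled to a seat but has none could take over
    a seat whose removal unrepresents fewer voters, and if an unrepresented
    voter could change the outcome, both outcomes would be optimal for both
    profiles, so that the tie-breaking order would rank each above the other.

    Any other admissible w has w_2 > 0.  If w_2 = 1, then two voters for x are
    ignored when six others are split evenly between two parties that get two
    of the four seats each.  If w_2 < 1, place many voters on a 2 x 2 grid of
    cells whose two row parties, like its two column parties, represent
    everybody; for k = 2 only these two pairs can be optimal.  One extra voter
    for the first row and one for the first column make the pairs tie, so one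
    of the two is unrepresented, and she wins by also approving the second line
    of her direction, which adds w_2 > 0 to her pair. *)

Require Import Defs.
From mathcomp Require Import all_boot all_order all_algebra.
From mathcomp Require Import reals.
From mathcomp Require Import boolp zify lra.
Set Implicit Arguments.
Unset Strict Implicit.
Unset Printing Implicit Defensive.
Import Order.TTheory GRing.Theory Num.Theory.
Local Open Scope ring_scope.

(** * Committees and profiles with prescribed entries *)

Lemma committee_sum (m k : nat) (W : committee m k) :
  (\sum_x val W x)%N = k.
Proof. exact/eqP/(valP W). Qed.

Lemma committee_ext (m k : nat) (W W' : committee m k) :
  (forall x, val W x = val W' x :> nat) -> W = W'.
Proof. by move=> eqW; apply/val_inj/ffunP => x; apply/val_inj/eqW. Qed.

Lemma committee_exists (m k : nat) (g : 'I_m -> nat) :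
  (\sum_x g x)%N = k -> exists W : committee m k, forall x, val W x = g x :> nat.
Proof.
move=> sum_g.
have gk x : (g x < k.+1)%N by rewrite ltnS -sum_g (bigD1 x) //= leq_addr.
pose W := [ffun x => Ordinal (gk x)].
have sumW : (\sum_x W x)%N == k.
  by rewrite -[X in _ == X]sum_g; apply/eqP/eq_bigr => x _; rewrite ffunE.
by exists (exist _ W sumW) => x; rewrite /= ffunE.
Qed.

Lemma profile_exists (m n : nat) (B : 'I_n -> {set 'I_m}) :
  (forall i, B i != set0) -> exists A : profile m n, forall i, val (A i) = B i.
Proof.
move=> B0; exists [ffun i => exist (fun X : {set 'I_m} => X != set0) _ (B0 i)].
by move=> i; rewrite ffunE.
Qed.

Lemma seats1 (m k : nat) (W : committee m k) (x : 'I_m) :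
  seats W [set x] = val W x.
Proof. by rewrite /seats big_set1. Qed.

Lemma thiele_spec (R : realType) (w : nat -> R) (m n k : nat)
    (tie : rel (committee m k)) (m_gt0 : (0 < m)%N) (A : profile m n) :
  linear_order tie ->
  optimal w A (thiele w tie m_gt0 A) /\
  forall W, optimal w A W -> tie (thiele w tie m_gt0 A) W.
Proof. by move=> tieP; apply/(thieleP _ m_gt0). Qed.

(** * CCAV satisfies both axioms *)

Lemma ccav_partial_sum (R : realType) (t : nat) :
  \sum_(j < t) ccav_weights R j = (0 < t)%:R.
Proof.
case: t => [|t]; first by rewrite big_ord0.
by rewrite big_ord_recl big1 ?addr0 // => j _.
Qed.

Lemma ccav_scoreE (R : realType) (m n k : nat) (A : profile m n)
    (W : committee m k) :
  score (ccav_weights R) A W = (\sum_(i < n) (0 < seats W (val (A i))))%N%:R.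
Proof.
by rewrite /score natr_sum; apply: eq_bigr => i _; exact: ccav_partial_sum.
Qed.

(** If [x] had no seat, at most [n - #|G|] voters would have exactly one representative. By
    averaging over the [k] seats, some seat is the only one of fewer than [#|G|] voters, and moving
    it to [x] raises the score. *)
Lemma ccav_weak_representation (R : realType) (m n k : nat)
    (tie : rel (committee m k)) (m_gt0 : (0 < m)%N) :
  linear_order tie -> (0 < k)%N -> (0 < n)%N ->
  weak_representation (thiele (ccav_weights R) tie m_gt0 : rule m n k).
Proof.
move=> tieP k_gt0 n_gt0 A x G leG GA.
have [/forallP optW _] := thiele_spec (ccav_weights R) m_gt0 A tieP.
move: (thiele _ _ _ _) optW => W optW.
rewrite seats1 lt0n; apply/negP => /eqP Wx0.
have {leG} nkG : (n <= #|G| * k)%N.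
  by move: leG; rewrite ler_pdivrMr ?ltr0n // -natrM ler_nat.
(* When [y] has a seat, these are the voters represented by that seat alone. *)
pose lost y := (\sum_i ((y \in val (A i)) && (seats W (val (A i)) == 1)))%N.
have [y Wy lost_y] : exists2 y, (0 < val W y)%N & (lost y < #|G|)%N.
  apply: contrapT => nex.
  have H y : (0 < val W y)%N -> (#|G| <= lost y)%N.
    by move=> Wy; rewrite leqNgt; apply/negP => ltG; apply: nex; exists y.
  (* Weighting each lost voter by seats counts a voter with exactly one
     representative once, and no other voter. *)
  have sumG : (\sum_y val W y * lost y <= \sum_i (i \notin G))%N.
    under eq_bigr do rewrite /lost big_distrr /=.
    rewrite exchange_big /=; apply: leq_sum => i _.
    have -> : (\sum_j val W j * ((j \in val (A i)) && (seats W (val (A i)) == 1)))%N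
       = (seats W (val (A i)) * (seats W (val (A i)) == 1%N))%N.
      rewrite {2}/seats big_distrl /= [RHS]big_mkcond /=; apply: eq_bigr => j _.
      by case: (j \in _); rewrite ?muln0.
    have [iG|iG] := boolP (i \in G); first by rewrite GA // seats1 Wx0.
    by case: eqP => [->|]; rewrite ?muln0.
  have leS : (k * #|G| <= \sum_y val W y * lost y)%N.
    rewrite -{1}(committee_sum W) big_distrl /=; apply: leq_sum => y _.
    have [->//|Wy] := posnP (val W y).
    by rewrite leq_mul2l H ?orbT.
  have : (\sum_i (i \notin G) + #|G| = n)%N.
    rewrite -sum1_card [X in (_ + X)%N]big_mkcond -big_split /=.
    rewrite -[RHS]card_ord -sum1_card; apply: eq_bigr => i _.
    by case: (i \in G).
  nia.
have sum_ind (X : {set 'I_m}) z : (\sum_(t in X) (t == z) = (z \in X))%N.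
  rewrite big_mkcond (bigD1 z) //= eqxx big1 ?addn0; first by case: (_ \in _).
  by move=> t /negbTE ->; case: ifP.
have sum_indT (z : 'I_m) : (\sum_t (t == z) = 1)%N.
  transitivity (z \in [set: 'I_m] : nat); last by rewrite in_setT.
  by rewrite -sum_ind; apply: eq_bigl => t; rewrite in_setT.
(* Since [y] has a seat, the truncated subtraction is exact. *)
have gE z : (val W z - (z == y) + (z == x) + (z == y) = val W z + (z == x))%N.
  by case: eqP => [->|]; lia.
have [W' W'E] : exists W' : committee m k, forall z,
    val W' z = (val W z - (z == y) + (z == x))%N :> nat.
  apply: committee_exists; apply/eqP; rewrite -(eqn_add2r 1) -{1}(sum_indT y).
  rewrite -big_split /=; under eq_bigr do rewrite gE.
  by rewrite big_split /= committee_sum sum_indT.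
have seatsE (X : {set 'I_m}) :
    (seats W' X + (y \in X) = seats W X + (x \in X))%N.
  rewrite -!sum_ind /seats -!big_split /=; apply: eq_bigr => z _.
  by rewrite W'E gE.
(* Members of [G] become represented by [x]; any other voter who loses representation is counted by
   [lost y]. *)
have le_voter i : ((0 < seats W (val (A i))) + (i \in G) <=
    (0 < seats W' (val (A i))) +
    ((y \in val (A i)) && (seats W (val (A i)) == 1)))%N.
  have := seatsE (val (A i)); have [iG|iG] := boolP (i \in G).
    rewrite GA // !inE eqxx (seats1 W) Wx0.
    have -> : (y == x) = false by apply/eqP => yx; rewrite yx Wx0 in Wy.
    by rewrite addn0 => ->.
  by case: (y \in _); case: (x \in _);
     move: (seats W _) (seats W' _) => [|[|a]] [|b] //=; lia.
have := leq_sum (index_enum 'I_n) (P := xpredT) (fun i _ => le_voter i).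
rewrite !big_split /= => le_sums.
have := optW W'; rewrite !ccav_scoreE ler_nat leqNgt => /negP; apply.
rewrite -(ltn_add2r #|G|) -{1}sum1_card [X in (_ + X < _)%N]big_mkcond /=.
by apply: leq_ltn_trans le_sums _; rewrite ltn_add2l.
Qed.

Lemma ccav_strategyproof_unrepresented (R : realType) (m n k : nat)
    (tie : rel (committee m k)) (m_gt0 : (0 < m)%N) :
  linear_order tie ->
  strategyproof_unrepresented (thiele (ccav_weights R) tie m_gt0 : rule m n k).
Proof.
move=> tieP A A' i AA' W0.
have [optW bestW] := thiele_spec (ccav_weights R) m_gt0 A tieP.
have [optW' bestW'] := thiele_spec (ccav_weights R) m_gt0 A' tieP.
move: (thiele _ _ _ A) (thiele _ _ _ A') W0 optW bestW optW' bestW' =>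
  W W' W0 optW bestW optW' bestW'.
rewrite W0 leqNgt; apply/negP => W'_gt0.
pose rest (V : committee m k) : R :=
  \sum_(j < n | j != i) \sum_(l < seats V (val (A j))) ccav_weights R l.
have scoreA V : score (ccav_weights R) A V
    = (0 < seats V (val (A i)))%:R + rest V.
  by rewrite /score (bigD1 i) //= ccav_partial_sum.
have scoreA' V : score (ccav_weights R) A' V
    = (0 < seats V (val (A' i)))%:R + rest V.
  rewrite /score (bigD1 i) //= ccav_partial_sum; congr (_ + _).
  by apply: eq_bigr => j ji; rewrite AA'.
have leA := forallP optW W'; have leA' := forallP optW' W.
(* Voter [i] contributes 0 or 1. Optimality of [W] for [A] gives [rest W >= rest W' + 1], and that
   of [W'] for [A'] gives the reverse, so the committees tie in both profiles. *)
have sA : score (ccav_weights R) A W' = score (ccav_weights R) A W.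
  move: leA leA'; rewrite !scoreA !scoreA' W0 W'_gt0 ltnn.
  by case: (0 < _)%N; case: (0 < _)%N => /=; lra.
have sA' : score (ccav_weights R) A' W = score (ccav_weights R) A' W'.
  move: leA leA'; rewrite !scoreA !scoreA' W0 W'_gt0 ltnn.
  by case: (0 < _)%N; case: (0 < _)%N => /=; lra.
have WW' : tie W W'.
  by apply: bestW; apply/forallP => V; rewrite sA; exact: (forallP optW).
have W'W : tie W' W.
  by apply: bestW'; apply/forallP => V; rewrite sA'; exact: (forallP optW').
case: tieP => _ anti _ _.
by have e := anti W W' (introT andP (conj WW' W'W)); rewrite -e W0 in W'_gt0.
Qed.

(** * Bounds on admissible weights *)

Lemma admissible_le1 (R : realType) (w : nat -> R) (j : nat) :
  admissible w -> w j <= 1.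
Proof.
by case=> w0 _ wS; elim: j => [|j IH]; rewrite ?w0 //; exact: le_trans (wS j) IH.
Qed.

Lemma partial_sum_le (R : realType) (w : nat -> R) (t : nat) :
  admissible w -> \sum_(j < t) w j <= t%:R.
Proof.
move=> adm; rewrite -[t in t%:R]card_ord -sum1_card natr_sum.
by apply: ler_sum => j _; exact: admissible_le1.
Qed.

(** If [w 1] vanished, monotonicity would make all later weights vanish too. *)
Lemma admissible_second_gt0 (R : realType) (w : nat -> R) :
  admissible w -> w <> ccav_weights R -> 0 < w 1%N.
Proof.
case=> w0 w_ge0 wS w_neq; rewrite lt_neqAle w_ge0 andbT.
apply/negP => /eqP w1; apply: w_neq; apply/funext => -[|j] //.
rewrite /ccav_weights /=; elim: j => [//|j IH].
by apply/eqP; rewrite eq_le w_ge0 -IH wS.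
Qed.

(** * Second weight 1: failure of weak representation *)

(** Seats (0, 2, 2) score 12, while a committee with [t] seats for the first party scores at most
    [2 t + 3 (4 - t) = 12 - t]. Its two supporters meet the quota 8/4 exactly. *)
Lemma thiele_flat_violates_weak_representation (R : realType)
    (w : nat -> R) (tie : rel (committee 3 4)) (m_gt0 : (0 < 3)%N) :
  linear_order tie -> admissible w -> w 1%N = 1 ->
  ~ weak_representation (thiele w tie m_gt0 : rule 3 8 4).
Proof.
move=> tieP adm w1.
(* Two voters for party 0, three each for parties 1 and 2. *)
pose party (i : 'I_8) : 'I_3 := inord (i.+1 %/ 3).
have [A AE] : exists A : profile 3 8, forall i, val (A i) = [set party i].
  by apply: profile_exists => i; apply/set0Pn; exists (party i); rewrite inE.
have [W0 W0E] : exists W : committee 3 4, forall x,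
    val W x = (if x == ord0 then 0 else 2)%N :> nat.
  by apply: committee_exists; rewrite !big_ord_recl big_ord0.
have scoreE (W : committee 3 4) :
    score w A W = \sum_(i < 8) \sum_(j < val W (party i)) w j.
  by rewrite /score; apply: eq_bigr => i _; rewrite AE seats1.
move=> /(_ A ord0 [set i : 'I_8 | (i < 2)%N]).
have [/forallP /(_ W0) + _] := thiele_spec w m_gt0 A tieP.
move: (thiele _ _ _ _) => W optW.
have sum_two : \sum_(j < 2) w j = 2.
  by rewrite !big_ord_recl big_ord0 /= w1; case: adm => -> _ _; lra.
have W0_score : score w A W0 = 12.
  rewrite scoreE !big_ord_recl big_ord0 !W0E /party -!val_eqE /= !inordK //=.
  rewrite !sum_two !big_ord0; lra.
have W_score : score w A W <= 12 - (val W ord0)%:R.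
  rewrite scoreE.
  apply: le_trans (ler_sum _ (fun i _ => partial_sum_le (val W (party i)) adm)) _.
  have := congr1 (fun t : nat => t%:R : R) (committee_sum W).
  rewrite !big_ord_recl !big_ord0 !natrD /party /=.
  have -> : lift ord0 (lift ord0 ord0) = inord 2 :> 'I_3.
    by apply/val_inj; rewrite /= inordK.
  have -> : lift ord0 ord0 = inord 1 :> 'I_3 by apply/val_inj; rewrite /= inordK.
  have -> : ord0 = inord 0 :> 'I_3 by apply/val_inj; rewrite /= inordK.
  (* The voters' parties are evaluated by conversion, leaving a linear problem in three seat
     numbers. *)
  pose u j : R := (sval W (inord j))%:R.
  rewrite -[X in _ -> X <= _]/(u 0%N + (u 0%N + (u 1%N + (u 1%N + (u 1%N +
    (u 2%N + (u 2%N + (u 2%N + 0)))))))) -/(u 0%N) -/(u 1%N) -/(u 2%N).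
  lra.
have cardG : #|[set i : 'I_8 | (i < 2)%N]| = 2%N.
  by rewrite -sum1_card big_mkcond !big_ord_recl big_ord0 /= !inE.
have {}optW : 12 <= 12 - (val W ord0)%:R :> R.
  by rewrite -{1}W0_score (le_trans optW).
have Wx0 : val W ord0 = 0%N :> nat.
  by apply/eqP; rewrite -leqn0 -(ler_nat R); lra.
rewrite cardG seats1 Wx0 => H; suff: (1 <= 0)%N by [].
apply: H => [|i].
  by rewrite ler_pdivrMr ?ltr0n // -natrM ler_nat.
rewrite inE AE => i2; congr [set _]; apply/val_inj.
by rewrite /= inordK; lia.
Qed.

(** * Second weight below 1: failure of strategyproofness on a grid *)

(* Voter [inl (rc, l)] is the [l]-th copy of the cell in row [rc.1] and column
   [rc.2] of a 2 x 2 grid; party [(true, r)] is row [r] and party [(false, c)]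
   is column [c].  Voter [inr d] approves line 0 of direction [d], and
   additionally line 1 when [q d] holds. *)
Definition grid_ballot (L : nat) (q : bool -> bool)
    (v : (bool * bool) * 'I_L + bool) : {set bool * bool} :=
  match v with
  | inl (rc, _) => [set (true, rc.1); (false, rc.2)]
  | inr d => (d, false) |: (if q d then [set (d, true)] else set0)
  end.

(** Parties have to be ordinals; this carries seat counts back to the structured parties of the
    grid. *)
Lemma seats_enum_val (P : finType) (k : nat) (W : committee #|P| k)
    (B : {set P}) :
  seats W [set p | enum_val p \in B] = (\sum_(b in B) val W (enum_rank b))%N.
Proof.
rewrite /seats [RHS](reindex_onto enum_val enum_rank) /=; last first.
  by move=> b _; rewrite enum_rankK.
by apply: eq_big => [p|p _]; rewrite ?inE enum_valK ?eqxx ?andbT.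
Qed.

Definition grid_profile (L : nat) (q : bool -> bool)
    (A : profile #|{: bool * bool}| #|{: (bool * bool) * 'I_L + bool}|) : Prop :=
  forall i, val (A i) = [set p | enum_val p \in grid_ballot q (enum_val i)].

Lemma grid_profile_exists (L : nat) (q : bool -> bool) :
  exists A, @grid_profile L q A.
Proof.
apply: profile_exists => i; apply/set0Pn.
suff [b b_in] : exists b, b \in grid_ballot q (enum_val i).
  by exists (enum_rank b); rewrite inE enum_rankK.
case: (enum_val i) => [[rc l]|d]; first by exists (true, rc.1); rewrite !inE eqxx.
by exists (d, false); rewrite !inE eqxx.
Qed.

(** The [L] copies of a cell contribute alike; the second summand comes from the two extra
    voters. *)
Lemma grid_scoreE (R : realType) (w : nat -> R) (L : nat) (q : bool -> bool)
    (A : profile #|{: bool * bool}| #|{: (bool * bool) * 'I_L + bool}|)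
    (k : nat) (W : committee #|{: bool * bool}| k) :
  grid_profile q A ->
  let u d b := val W (enum_rank (d, b)) : nat in
  score w A W =
    (\sum_(rc : bool * bool) \sum_(j < u true rc.1 + u false rc.2) w j) *+ L
    + \sum_(d : bool) \sum_(j < u d false + q d * u d true) w j.
Proof.
move=> AE u.
pose f (v : (bool * bool) * 'I_L + bool) : R :=
  \sum_(j < \sum_(b in grid_ballot q v) val W (enum_rank b)) w j.
have -> : score w A W = \sum_(v : (bool * bool) * 'I_L + bool) f v.
  rewrite [RHS]big_enum_val; apply: eq_bigr => i _.
  by rewrite AE seats_enum_val.
rewrite big_sumType; congr (_ + _).
  transitivity (\sum_(rc : bool * bool) \sum_(l < L) f (inl (rc, l))).
    by rewrite pair_bigA; apply: eq_bigr => -[].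
  rewrite -sumrMnl.
  apply: eq_bigr => rc _; rewrite /f /= sumr_const card_ord; congr (_ *+ _).
  by rewrite big_setU1 ?inE // big_set1.
apply: eq_bigr => d _; rewrite /f /= big_setU1; last first.
  by case: (q d); rewrite !inE // xpair_eqE andbF.
by case: (q d); rewrite ?big_set1 ?big_set0 ?mul1n.
Qed.

Lemma big_bool_pair (T : Type) (idx : T) (op : Monoid.com_law idx)
    (F : bool * bool -> T) :
  \big[op/idx]_p F p = op (op (F (true, true)) (F (true, false)))
                          (op (F (false, true)) (F (false, false))).
Proof.
transitivity (\big[op/idx]_(b : bool) \big[op/idx]_(c : bool) F (b, c)).
  by rewrite pair_bigA; apply: eq_bigr => -[].
by rewrite !big_bool.
Qed.

Lemma thiele_grid_violates_strategyproofness (R : realType) (w : nat -> R)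
    (tie : rel (committee #|{: bool * bool}| 2))
    (m_gt0 : (0 < #|{: bool * bool}|)%N) :
  linear_order tie -> admissible w -> 0 < w 1%N -> w 1%N < 1 ->
  exists L : nat, ~ strategyproof_unrepresented
    (thiele w tie m_gt0 : rule _ #|{: (bool * bool) * 'I_L + bool}| 2).
Proof.
move=> tieP adm w1_gt0 w1_lt1; have [w0 w_ge0 _] := adm.
have S0 : \sum_(j < 0) w j = 0 by rewrite big_ord0.
have S1 : \sum_(j < 1) w j = 1 by rewrite big_ord_recl big_ord0 w0 addr0.
have S2 : \sum_(j < 2) w j = 1 + w 1%N.
  by rewrite !big_ord_recl !big_ord0 w0 addr0.
(* Per copy of the grid, a committee other than the two line pairs loses at least [1 - w 1]; this
   [L] makes the loss outweigh anything the extra voters can add. *)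
pose L := (Num.bound (3 / (1 - w 1%N))).
have L_big : 3 < (1 - w 1%N) * L%:R.
  have := archi_boundP (_ : 0 <= 3 / (1 - w 1%N)).
  rewrite divr_ge0 ?subr_ge0 ?ltW // => /(_ isT).
  by rewrite ltr_pdivrMr ?subr_gt0 // mulrC.
exists L => SP.
have line d : exists W : committee #|{: bool * bool}| 2,
    forall d' b, val W (enum_rank (d', b)) = (d' == d) :> nat.
  have [|W WE] := @committee_exists #|{: bool * bool}| 2
    (fun p => ((enum_val p).1 == d) : nat).
    rewrite -(big_enum_val (A := {: bool * bool})
      (fun p : bool * bool => ((p.1 == d) : nat))) /=.
    by rewrite big_bool_pair; case: d.
  by exists W => d' b; rewrite WE enum_rankK.
have [D DE] : exists D : bool -> committee #|{: bool * bool}| 2,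
    forall d d' b, val (D d) (enum_rank (d', b)) = (d' == d) :> nat.
  by have [Dt Dt_E] := line true; have [Df DfE] := line false;
     exists (fun d => if d then Dt else Df) => -[].
have line_score q A : @grid_profile L q A ->
    forall d, score w A (D d) = 4 * L%:R + 1 + (if q d then w 1%N else 0).
  move=> AE d; rewrite (grid_scoreE w (D d) AE) big_bool_pair big_bool /=.
  rewrite !DE /=.
  by case: d; [case: (q true)|case: (q false)];
    rewrite ?muln0 ?mul1n ?mul0n ?addn0 ?add0n ?S0 ?S1 ?S2 -[_ *+ L]mulr_natr;
    lra.
(* Rows get [a], [b] seats and columns [c], [e]. A row with a column yields [3 + w 1], a doubled
   line only [2 + 2 w 1], and the line pairs yield 4. *)
have block_le a b c e : (a + b + (c + e))%N = 2%N ->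
    [\/ [/\ a = 1, b = 1, c = 0 & e = 0]%N, [/\ a = 0, b = 0, c = 1 & e = 1]%N
     | \sum_(j < a + c) w j + \sum_(j < a + e) w j +
       (\sum_(j < b + c) w j + \sum_(j < b + e) w j) <= 3 + w 1%N].
  case: a => [|[|[|a]]]; case: b => [|[|[|b]]]; case: c => [|[|[|c]]] //;
    case: e => [|[|[|e]]] // _; by
    [ constructor 1 | constructor 2
    | constructor 3; rewrite ?addn0 ?add0n ?addn1 ?S0 ?S1 ?S2; lra].
have optimal_line q A W : @grid_profile L q A ->
    optimal w A W -> exists d, W = D d.
  move=> AE /forallP /(_ (D true)); rewrite (line_score _ _ AE).
  rewrite (grid_scoreE w W AE) big_bool_pair big_bool /= => W_best.
  suff [d Wd] : exists d, forall d' b,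
      val W (enum_rank (d', b)) = (d' == d) :> nat.
    exists d; apply: committee_ext => x; rewrite -(enum_valK x).
    by case: (enum_val x) => d' b; rewrite Wd DE.
  have := committee_sum W.
  rewrite (reindex_onto enum_rank enum_val) /=; last first.
    by move=> x _; rewrite enum_valK.
  under eq_bigl do rewrite enum_rankK eqxx.
  rewrite big_bool_pair /= => sum_u.
  (* One extra voter approves only rows, the other only columns, so each seat counts at most
     once. *)
  have extras_le : \sum_(j < val W (enum_rank (true, false)) +
      q true * val W (enum_rank (true, true))) w j +
    \sum_(j < val W (enum_rank (false, false)) +
      q false * val W (enum_rank (false, true))) w j <= 2.
    apply: le_trans (lerD (partial_sum_le _ adm) (partial_sum_le _ adm)) _.
    rewrite -natrD ler_nat -[X in (_ <= X)%N]sum_u.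
    by case: (q true); case: (q false); rewrite /=; lia.
  case: (block_le _ _ _ _ sum_u) => [[t1 t0 f1 f0]|[t1 t0 f1 f0]|blockW].
  - by exists true => -[] [].
  - by exists false => -[] [].
  move: W_best; rewrite -[X in _ <= X + _]mulr_natr => W_best.
  have := ler_wpM2r (ler0n R L) blockW.
  have : 0 <= (if q true then w 1%N else 0) by case: ifP.
  move: extras_le L_big W_best => /= *; exfalso; lra.
have [A AE] := grid_profile_exists L (fun=> false).
have [optA _] := thiele_spec w m_gt0 A tieP.
have [d Ad] := optimal_line _ _ _ AE optA.
have [A' A'E] := grid_profile_exists L (fun d' => d' == ~~ d).
have [optA' _] := thiele_spec w m_gt0 A' tieP.
have [d' A'd'] := optimal_line _ _ _ A'E optA'.
(* Her second approval lifts [D (~~ d)] above [D d] by [w 1 > 0], so tie-breaking no longer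
   matters. *)
have {}A'd' : thiele w tie m_gt0 A' = D (~~ d).
  move/forallP: optA' => /(_ (D (~~ d))).
  rewrite A'd' !(line_score _ _ A'E) eqxx.
  by case: eqP => [d'E _|_ ?]; [rewrite d'E | exfalso; lra].
have := SP A A' (enum_rank (inr (~~ d))).
rewrite Ad A'd' AE enum_rankK !seats_enum_val /= setU0 !big_set1 !DE eqxx.
have -> : (~~ d == d) = false by case: (d).
suff same_others : forall j, j != enum_rank (inr (~~ d)) -> A j = A' j.
  by move=> /(_ same_others erefl).
move=> i id; apply/val_inj; rewrite AE A'E; apply/setP => p; rewrite !inE.
have {id} : enum_val i != inr (~~ d).
  by apply: contraNneq id => <-; rewrite enum_valK.
case: (enum_val i) => [[]//|d'' /= neq].
have -> // : (d'' == ~~ d) = false.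
  by apply/negP => /eqP dd; rewrite dd eqxx in neq.
Qed.

(** * Characterization of CCAV among Thiele rules *)

Unset Implicit Arguments.

Theorem theorem3 (R : realType) (tie : forall m k : nat, rel (committee m k))
    (tieP : forall m k : nat, linear_order (tie m k)) :
  (forall (k m n : nat) (m_gt0 : (0 < m)%N), (0 < k)%N -> (0 < n)%N ->
     let f : rule m n k := thiele (@ccav_weights R) (tie m k) m_gt0 in
     weak_representation f /\ strategyproof_unrepresented f)
  /\
  (forall w : nat -> R, admissible w -> w <> @ccav_weights R ->
     exists (k m n : nat) (m_gt0 : (0 < m)%N),
       let f : rule m n k := thiele w (tie m k) m_gt0 in
       [/\ (0 < k)%N, (0 < n)%N
         & ~ weak_representation f \/ ~ strategyproof_unrepresented f]).
Proof.
split=> [k m n m_gt0 k_gt0 n_gt0|w adm w_neq] /=.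
  split; first exact: ccav_weak_representation.
  exact: ccav_strategyproof_unrepresented.
have w1_gt0 := admissible_second_gt0 adm w_neq.
have := admissible_le1 1 adm; rewrite le_eqVlt => /orP[/eqP w1|w1_lt1].
  exists 4%N, 3%N, 8%N, isT; split=> //; left.
  exact: thiele_flat_violates_weak_representation.
have m_gt0 : (0 < #|{: bool * bool}|)%N by rewrite card_prod card_bool.
have [L notSP] := thiele_grid_violates_strategyproofness m_gt0 (tieP _ _)
  adm w1_gt0 w1_lt1.
exists 2%N, #|{: bool * bool}|, #|{: (bool * bool) * 'I_L + bool}|, m_gt0.
split=> //; last by right; exact: notSP.
by rewrite card_sum card_bool addn2.
Qed.
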